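(* Let $n\ge 1$, let $\xi_1,\dots,\xi_n$ be $n$ distinct points on the unit circle $\mathbb{T}=\{|\zeta|=1\}$, and let $\nu_1,\dots,\nu_n>0$ with $\sum_{j=1}^n\nu_j=1$. Then there is a unique $n\times n$ finite CMV matrix $\mathcal{C}=\mathcal{C}(\alpha_0,\dots,\alpha_{n-2};\beta)$ (with $|\alpha_j|<1$, $|\beta|=1$) whose $n$-th spectral measure is $\sum_{j=1}^n\nu_j\,\delta(\xi_j)$.
   Context: For $\alpha\in\mathbb{C}$ with $|\alpha|\le 1$ put $\rho=\sqrt{1-|\alpha|^2}$ and $\Theta(\alpha)=\begin{pmatrix}\bar\alpha&\rho\\ \rho&-\alpha\end{pmatrix}$. Given $\alpha_0,\dots,\alpha_{n-2}$ with $|\alpha_j|<1$ and $\beta$ with $|\beta|=1$, the finite CMV matrix $\mathcal{C}(\alpha_0,\dots,\alpha_{n-2};\beta)$ of order $n$ is the $n\times n$ unitary matrix $\mathcal{L}\mathcal{M}$, where: if $n=2k+1$, $\mathcal{L}=\Theta(\alpha_0)\oplus\Theta(\alpha_2)\oplus\cdots\oplus\Theta(\alpha_{2k-2})\oplus\bar\beta$ and $\mathcal{M}=1\oplus\Theta(\alpha_1)\oplus\Theta(\alpha_3)\oplus\cdots\oplus\Theta(\alpha_{2k-1})$; if $n=2k$, $\mathcal{L}=\Theta(\alpha_0)\oplus\Theta(\alpha_2)\oplus\cdots\oplus\Theta(\alpha_{2k-2})$ and $\mathcal{M}=1\oplus\Theta(\alpha_1)\oplus\cdots\oplus\Theta(\alpha_{2k-3})\oplus\bar\beta$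 (here $1$ and $\bar\beta$ denote $1\times1$ blocks). Such a matrix has $n$ distinct eigenvalues $\zeta_1,\dots,\zeta_n\in\mathbb{T}$ with an orthonormal eigenbasis $h_1,\dots,h_n$ of $\mathbb{C}^n$. With $e_n$ the last standard basis vector of $\mathbb{C}^n$, the $n$-th spectral measure of $\mathcal{C}$ is $\sum_{j=1}^n|(h_j,e_n)|^2\,\delta(\zeta_j)$, i.e. the spectral measure of $\mathcal{C}$ associated with the vector $e_n$; $\delta(\zeta)$ denotes the unit point mass at $\zeta$. *)

(* Defs.v *)
From mathcomp Require Import all_boot all_algebra.
From mathcomp Require Import reals.
From mathcomp.real_closed Require Import complex.
Import GRing.Theory Num.Theory.
Set Implicit Arguments. Unset Strict Implicit. Unset Printing Implicit Defensive.
Local Open Scope ring_scope.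

Section CMV.
Variable C : numClosedFieldType.

Definition rho (a : C) : C := sqrtC (1 - `|a| ^+ 2).

Definition theta (a : C) (r c : nat) : C :=
  if r == 0%N then (if c == 0%N then a^* else rho a)
  else (if c == 0%N then rho a else - a).

(* alpha_k for k : nat (0 outside the index range; never used there) *)
Definition aget (m : nat) (alpha : 'I_m -> C) (k : nat) : C :=
  if insub k is Some i then alpha i else 0.

(* L = Theta(alpha_0) (+) Theta(alpha_2) (+) ... [(+) conj beta if n odd] *)
Definition CMV_L (m : nat) (alpha : 'I_m -> C) (beta : C) : 'M[C]_m.+1 :=
  \matrix_(i, j)
    let b := (i./2).*2 in
    if (b.+1 < m.+1)%N then
      (if i./2 == j./2 then theta (aget alpha b) (i - b) (j - b) else 0)
    else (if (j : nat) == i then beta^* else 0).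

(* M = 1 (+) Theta(alpha_1) (+) Theta(alpha_3) (+) ... [(+) conj beta if n even] *)
Definition CMV_M (m : nat) (alpha : 'I_m -> C) (beta : C) : 'M[C]_m.+1 :=
  \matrix_(i, j)
    if (i : nat) == 0%N then (if (j : nat) == 0%N then 1 else 0)
    else if (j : nat) == 0%N then 0
    else
      let i' := (i : nat).-1 in let j' := (j : nat).-1 in
      let b := (i'./2).*2 in
      if (b.+2 < m.+1)%N then
        (if i'./2 == j'./2 then theta (aget alpha b.+1) (i' - b) (j' - b) else 0)
      else (if (j : nat) == i then beta^* else 0).

Definition CMV (m : nat) (alpha : 'I_m -> C) (beta : C) : 'M[C]_m.+1 :=
  CMV_L alpha beta *m CMV_M alpha beta.

(* A finitely supported measure sum_j w_j delta(z_j), represented by its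
   mass function x |-> mu({x}) (complete description of a finite discrete measure). *)
Definition point_masses (k : nat) (z : 'I_k -> C) (w : 'I_k -> C) : C -> C :=
  fun x => \sum_(j < k) w j * (x == z j)%:R.

(* mu is the n-th spectral measure of A (n = m.+1): the spectral measure of A
   associated with e_n, i.e. sum_j |(h_j, e_n)|^2 delta(zeta_j) for an
   orthonormal eigenbasis h_1..h_n (columns of H) with eigenvalues zeta_j. *)
Definition nth_spectral_measure (m : nat) (A : 'M[C]_m.+1) (mu : C -> C) : Prop :=
  exists (zeta : 'I_m.+1 -> C) (H : 'M[C]_m.+1),
    ((map_mx Num.conj H)^T *m H = 1%:M) /\
    (forall j, A *m col j H = zeta j *: col j H) /\
    mu = point_masses zeta (fun j => `|H ord_max j| ^+ 2).

End CMV.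

(* Main.v *)
(** In the reversed basis [e_n, ..., e_1], the CMV matrix of order [n] (for [n]
    even) or its transpose (for [n] odd) satisfies
    [F_n = Theta(alpha_(n-2)) (conj beta (+) F_(n-1)^T)], where [Theta] acts on
    the first two coordinates and [F_(n-1)] is built with [beta = 1].
    So the first column of [F_n] determines [alpha_(n-2)], the determinant
    determines [beta], and both existence and uniqueness follow by induction.
    Two matrices with the same spectral measure at [e_n] are conjugate by a
    unitary fixing [e_n]; such a unitary splits off one basis vector at each step,
    which gives uniqueness. For existence, start from a unitary [U] with no
    eigenvector orthogonal to [e_n]; a unitary fixing [e_n] brings [U e_n] to
    the form prescribed by [Theta], and stripping [Theta] leaves a smaller
    matrix with the same property. *)

Require Import Defs.
From HB Require Import structures.
From mathcomp Require Import all_boot all_order all_algebra.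
From mathcomp Require Import zify ring.
From mathcomp Require Import boolp reals.
From mathcomp.real_closed Require Import complex.
Import Order.TTheory GRing.Theory Num.Theory.
Set Implicit Arguments. Unset Strict Implicit. Unset Printing Implicit Defensive.
Local Open Scope ring_scope.

(* Locked, since [mxE] would otherwise rewrite through the block structure. *)
HB.lock Definition dsum (C : nzRingType) n (c : C) (A : 'M[C]_n) : 'M[C]_n.+1 :=
  block_mx (c%:M : 'M_1) 0 0 A.

HB.lock Definition vcons (C : nzRingType) n (y : C) (x : 'cV[C]_n) : 'cV[C]_n.+1 :=
  col_mx (y%:M : 'M_1) x.

(** * Unitary matrices and splitting off the first coordinate *)

Section Unitary.
Local Open Scope sesquilinear_scope.
Variable C : numClosedFieldType.

Lemma unitarymxCP n (M : 'M[C]_n) :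
  reflect (M^t* *m M = 1%:M) (M \is unitarymx).
Proof.
by rewrite -trmxC_unitary -{2}(trmxCK M); apply: unitarymxP.
Qed.

Lemma mulmx_trmxCA m n (W : 'M[C]_m) (A : 'M[C]_(m, n)) :
  W \is unitarymx -> W^t* *m (W *m A) = A.
Proof. by move=> /unitarymxCP W1; rewrite mulmxA W1 mul1mx. Qed.

Lemma mulmx_unitary_inj m n (W : 'M[C]_m) (A B : 'M[C]_(m, n)) :
  W \is unitarymx -> W *m A = W *m B -> A = B.
Proof.
by move=> Wu AB; rewrite -(mulmx_trmxCA A Wu) AB mulmx_trmxCA.
Qed.

Lemma mul_dsum n c d (A B : 'M[C]_n) :
  dsum c A *m dsum d B = dsum (c * d) (A *m B).
Proof.
rewrite dsum.unlock; apply: etrans (@mulmx_block _ 1 n 1 n 1 n _ _ _ _ _ _ _ _) _.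
by rewrite !(mul0mx, mulmx0, add0r, addr0) -scalar_mxM.
Qed.

Lemma tr_dsum n c (A : 'M[C]_n) : (dsum c A)^T = dsum c A^T.
Proof.
rewrite dsum.unlock; apply: etrans (@tr_block_mx _ 1 n 1 n _ _ _ _) _.
by rewrite !trmx0 tr_scalar_mx.
Qed.

Lemma trC_dsum n c (A : 'M[C]_n) : (dsum c A)^t* = dsum c^* (A^t*).
Proof.
rewrite tr_dsum dsum.unlock; apply: etrans (@map_block_mx _ _ _ 1 n 1 n _ _ _ _) _.
by rewrite !map_mx0 map_scalar_mx.
Qed.

Lemma dsum1 n : dsum 1 1%:M = 1%:M :> 'M[C]_n.+1.
Proof. by rewrite dsum.unlock (@scalar_mx_block _ 1 n). Qed.

Lemma det_dsum n c (A : 'M[C]_n) : \det (dsum c A) = c * \det A.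
Proof. by rewrite dsum.unlock (@det_ublock _ 1 n) det_scalar1. Qed.

Lemma dsum_inj n c d (A B : 'M[C]_n) :
  dsum c A = dsum d B -> c = d /\ A = B.
Proof.
rewrite dsum.unlock => /(@eq_block_mx _ 1 n 1 n)[/matrixP/(_ 0 0) cd _ _ ->].
by move: cd; rewrite !mxE !mulr1n.
Qed.

Lemma dsumE0 n c (A : 'M[C]_n) i : dsum c A i 0 = c * (i == 0)%:R.
Proof.
rewrite dsum.unlock !mxE; case: splitP => k ik; rewrite !mxE; case: splitP => l //= _.
  by rewrite !ord1 mxE eqxx mulr1n -val_eqE /= ik ord1 mulr1.
by rewrite mxE -val_eqE /= ik mulr0.
Qed.

Lemma vcons0E n y (x : 'cV[C]_n) : vcons y x 0 0 = y.
Proof.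
rewrite vcons.unlock mxE; case: splitP => k //= _.
by rewrite !ord1 mxE mulr1n.
Qed.

Lemma vconsSE n y (x : 'cV[C]_n) i : vcons y x (lift 0 i) 0 = x i 0.
Proof. by rewrite vcons.unlock -rshift1; exact: (@col_mxEd _ 1 n 1). Qed.

Lemma vcons_surj n (x : 'cV[C]_n.+1) : exists x', x = vcons (x 0 0) x'.
Proof.
exists (\col_i x (lift 0 i) 0); apply/colP => i.
by case: (unliftP 0 i) => [k ->|->]; rewrite ?vcons0E ?vconsSE ?mxE.
Qed.

Lemma vcons_inj n y z (x x' : 'cV[C]_n) :
  vcons y x = vcons z x' -> y = z /\ x = x'.
Proof.
move=> e; split; first by rewrite -(vcons0E y x) e vcons0E.
by apply/colP => i; rewrite -(vconsSE y) e vconsSE.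
Qed.

Lemma vcons0 n : vcons 0 0 = 0 :> 'cV[C]_n.+1.
Proof.
apply/colP => i.
by case: (unliftP 0 i) => [k ->|->]; rewrite ?vcons0E ?vconsSE ?mxE.
Qed.

Lemma scale_vcons n c y (x : 'cV[C]_n) : c *: vcons y x = vcons (c * y) (c *: x).
Proof.
apply/colP => i; case: (unliftP 0 i) => [k ->|->];
  by rewrite ?(vcons0E, vconsSE, mxE) ?(vcons0E, vconsSE).
Qed.

Lemma mul_dsum_vcons n c y (A : 'M[C]_n) x :
  dsum c A *m vcons y x = vcons (c * y) (A *m x).
Proof.
rewrite dsum.unlock vcons.unlock.
apply: etrans (@mul_block_col _ 1 n 1 n 1 _ _ _ _ _ _) _.
by rewrite !mul0mx addr0 add0r -scalar_mxM.
Qed.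

Lemma mul_trC_vcons n y z (x x' : 'cV[C]_n) :
  (vcons y x)^t* *m vcons z x' = (y^* * z)%:M + x^t* *m x'.
Proof.
apply/matrixP=> i j; rewrite !ord1 [RHS]mxE [X in _ = _ + X]mxE [LHS]mxE big_ord_recl.
rewrite mxE mxE mxE !vcons0E mulr1n; congr (_ + _).
by apply: eq_bigr => k _; rewrite [in LHS]mxE mxE vconsSE vconsSE [in RHS]mxE mxE.
Qed.

Lemma dsumES n c (A : 'M[C]_n) i j : dsum c A (lift 0 i) (lift 0 j) = A i j.
Proof. by rewrite -!rshift1 dsum.unlock; exact: (@block_mxEdr _ 1 n 1 n). Qed.

Lemma dsum0E n c (A : 'M[C]_n) i : dsum c A 0 i = c * (i == 0)%:R.
Proof. by rewrite -[RHS](dsumE0 c A^T) -tr_dsum [RHS]mxE. Qed.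

Lemma dsum_unitary n c (A : 'M[C]_n) :
  (dsum c A \is unitarymx) = (`|c| == 1) && (A \is unitarymx).
Proof.
have c2 : (c * c^* == 1) = (`|c| == 1).
  by rewrite -normCK (@pexpr_eq1 _ _ 2) ?normr_ge0.
apply/unitarymxP/andP.
  rewrite trC_dsum mul_dsum -[RHS]dsum1 => /dsum_inj[cc AA]; split.
    by rewrite -c2 cc.
  exact/unitarymxP.
case=> /eqP c1 /unitarymxP A1; rewrite trC_dsum mul_dsum A1 -dsum1.
by congr dsum; apply/eqP; rewrite c2 c1.
Qed.

(* By unitarity, a first column proportional to [e_0] forces the first row to be so. *)
Lemma unitary_col0 n (W : 'M[C]_n.+1) c : W \is unitarymx ->
  W *m vcons 1 0 = vcons c 0 ->
  exists2 A : 'M[C]_n, W = dsum c A & A \is unitarymx.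
Proof.
move=> Wu We.
have W0 i : W i 0 = c * (i == 0)%:R.
  have -> : W i 0 = (W *m vcons 1 0) i 0.
    rewrite mxE (bigD1 0) //= vcons0E mulr1 big1 ?addr0 // => k.
    by case: (unliftP 0 k) => [l ->|->] //; rewrite vconsSE mxE mulr0.
  rewrite We; case: (unliftP 0 i) => [l ->|->]; last by rewrite vcons0E mulr1.
  by rewrite vconsSE mxE mulr0.
have W1 : W^t* *m W = 1%:M by apply/unitarymxCP.
have E j : c^* * W 0 j = (j == 0)%:R.
  move/matrixP/(_ 0 j): W1; rewrite !mxE eq_sym => <-.
  rewrite (bigD1 0) //= big1 ?addr0 => [|i i0]; rewrite !mxE W0.
    by rewrite eqxx mulr1.
  by rewrite (negPf i0) mulr0 conjC0 mul0r.
have c1 : c^* * c = 1 by have := E 0; rewrite W0 eqxx mulr1.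
have W0E j : W 0 j = c * (j == 0)%:R by rewrite -E mulrA [c * _]mulrC c1 mul1r.
pose A : 'M[C]_n := \matrix_(i, j) W (lift 0 i) (lift 0 j).
have WA : W = dsum c A.
  apply/matrixP=> i j; case: (unliftP 0 i) => [i' ->|->]; last by rewrite dsum0E.
  case: (unliftP 0 j) => [j' ->|->]; last by rewrite dsumE0 W0.
  by rewrite dsumES mxE.
by exists A => //; move: Wu; rewrite WA dsum_unitary => /andP[].
Qed.

(** Gram-Schmidt on the matrix with all rows equal to [v] gives a unitary whose first row is [v] up
    to a phase; [dsum c 1%:M] corrects the phase. *)
Lemma unitary_row0 n (v : 'rV[C]_n.+1) : v *m v^t* = 1%:M ->
  exists2 Q : 'M[C]_n.+1, Q \is unitarymx & row 0 Q = v.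
Proof.
move=> v1.
pose S := schmidt (\matrix_(i < n.+1) v).
have Su : S \is unitarymx by apply: schmidt_unitarymx.
have /sub_rVP[c vE] : (v <= row 0 S)%MS.
  have := row_schmidt_sub (\matrix_(i < n.+1) v) 0.
  rewrite rowK => /submx_trans; apply; apply/sumsmx_subP => k.
  by rewrite leqn0 => /eqP k0; rewrite genmxE (_ : k = 0) //; apply: val_inj.
have S0 : row 0 S *m (row 0 S)^t* = 1%:M.
  have /matrixP := unitarymxP Su => /(_ 0 0); rewrite !mxE => S00.
  by apply/matrixP=> i j; rewrite !ord1 !mxE -[RHS]S00; apply: eq_bigr => k _; rewrite !mxE.
exists (dsum c 1%:M *m S); last first.
  rewrite row_mul vE; apply/rowP=> j; rewrite !mxE (bigD1 0) //= big1 => [|k k0].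
    by rewrite !mxE dsum0E eqxx mulr1 addr0.
  by rewrite mxE dsum0E (negPf k0) mulr0 mul0r.
rewrite mul_unitarymx // dsum_unitary; apply/andP; split; last first.
  by apply/unitarymxP; rewrite trmx1 map_mx1 mulmx1.
move: v1; rewrite vE linearZ /= map_mxZ -scalemxAl -scalemxAr S0 => /matrixP/(_ 0 0).
by rewrite !mxE mulr1 -normCK => /eqP; rewrite (@pexpr_eq1 _ _ 2) ?normr_ge0.
Qed.

Lemma mulmx_cVP m n (A B : 'M[C]_(m, n)) :
  (forall x : 'cV_n, A *m x = B *m x) -> A = B.
Proof.
move=> AB; apply/matrixP => i j.
by have /colP/(_ i) := AB (delta_mx j 0); rewrite -!colE !mxE.
Qed.

End Unitary.

(* [Theta(a) (+) 1] in the reversed basis, hence the indices [1 - i]. *)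
HB.lock Definition theta0 (C : numClosedFieldType) m (a : C) : 'M[C]_m.+2 :=
  block_mx (\matrix_(i < 2, j < 2) theta a (1 - i) (1 - j)) 0 0 1%:M.

(** * Theta blocks, the recursive form, and its uniqueness *)

Section Theta.
Local Open Scope sesquilinear_scope.
Variable C : numClosedFieldType.

Lemma theta0E m (a : C) (i j : 'I_m.+2) : theta0 m a i j =
  if (i < 2)%N && (j < 2)%N then theta a (1 - i) (1 - j) else (i == j)%:R.
Proof.
rewrite theta0.unlock mxE; case: splitP => k ik; rewrite mxE;
  case: splitP => l jl; rewrite !mxE -?val_eqE /= ik jl ?(ltn_ord k) ?ltn_ord //=.
- by case: eqP => // kl; have := ltn_ord k; rewrite kl.
- by case: eqP => // kl; have := ltn_ord l; rewrite -kl.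
Qed.

Lemma sqr_rho (a : C) : rho a ^+ 2 = 1 - `|a| ^+ 2.
Proof. exact: sqrtCK. Qed.

Lemma rho_ge0 (a : C) : `|a| <= 1 -> 0 <= rho a.
Proof. by move=> a1; rewrite sqrtC_ge0 subr_ge0 expr_le1. Qed.

Lemma rho_gt0 (a : C) : `|a| < 1 -> 0 < rho a.
Proof. by move=> a1; rewrite sqrtC_gt0 subr_gt0 expr_lt1. Qed.

Lemma tr_theta0 m (a : C) : (theta0 m a)^T = theta0 m a.
Proof.
apply/matrixP=> i j; rewrite mxE !theta0E andbC [j == i]eq_sym.
case: ifP => // /andP[].
by case: i j => [[|[|?]] ?] [[|[|?]] ?].
Qed.

Lemma det_theta0 m (a : C) : \det (theta0 m a) = -1.
Proof.
rewrite theta0.unlock; apply: etrans (@det_ublock _ 2 m _ _ _) _.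
rewrite det1 mulr1 (expand_det_row _ 0) !big_ord_recl big_ord0 /cofactor !det_mx11 !mxE.
rewrite /= /theta /= expr0 expr1 mul1r mulN1r mulrN -expr2 sqr_rho normCK; ring.
Qed.

Lemma theta0_unitary m (a : C) : `|a| <= 1 -> theta0 m a \is unitarymx.
Proof.
move=> a1; have rr : (rho a)^* = rho a by apply/conj_Creal/ger0_real/rho_ge0.
have r2 : rho a * rho a = 1 - a * a^* by rewrite -expr2 sqr_rho normCK.
apply/unitarymxP; rewrite tr_theta0 theta0.unlock.
rewrite (@map_block_mx _ _ _ 2 m 2 m) !map_mx0 map_mx1.
apply: etrans (@mulmx_block _ 2 m 2 m 2 m _ _ _ _ _ _ _ _) _.
rewrite !(mul0mx, mulmx0, add0r, addr0) mulmx1 (@scalar_mx_block _ 2 m).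
congr block_mx; apply/matrixP=> i j; rewrite !mxE !big_ord_recl big_ord0 !mxE.
by case: i j => [[|[|?]] ?] [[|[|?]] ?] //=; rewrite /theta /= ?rmorphN /= ?conjCK ?rr
  ?(mulr1n, mulr0n) ?mulrN ?mulNr ?r2 /=; ring.
Qed.

Lemma mul_theta0_vcons m (a y z : C) (x : 'cV[C]_m) :
  theta0 m a *m vcons y (vcons z x) =
  vcons (- a * y + rho a * z) (vcons (rho a * y + a^* * z) x).
Proof.
have blockE (y' z' : C) : vcons y' (vcons z' x) =
    col_mx (\col_(i < 2) if i == 0 then y' else z') x.
  apply/colP => i; rewrite [RHS]mxE; case: splitP => k /= ik; last first.
    have [l Ei|Ei] := unliftP 0 i; last by rewrite Ei in ik.
    have [l' El|El] := unliftP 0 l; last by rewrite Ei El in ik.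
    rewrite Ei vconsSE El vconsSE; congr (x _ 0); apply: val_inj.
    by move: ik; rewrite Ei El /= /bump /= !add1n => -[].
  rewrite mxE; have [l Ei|Ei] := unliftP 0 i; last first.
    by rewrite Ei vcons0E -val_eqE /= -ik Ei.
  have [l' El|El] := unliftP 0 l; last first.
    by rewrite Ei vconsSE El vcons0E -val_eqE /= -ik Ei El.
  by have := ltn_ord k; rewrite -ik Ei El.
rewrite !blockE theta0.unlock; apply: etrans (@mul_block_col _ 2 m 2 m 1 _ _ _ _ _ _) _.
rewrite !mul0mx addr0 add0r mul1mx; congr col_mx.
apply/colP => i; rewrite !mxE !big_ord_recl big_ord0 !mxE addr0.
by case: i => [[|[|?]] ?].
Qed.

Lemma theta0_dsumC m (a : C) (A : 'M[C]_m) :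
  theta0 m a *m dsum 1 (dsum 1 A) = dsum 1 (dsum 1 A) *m theta0 m a.
Proof.
apply: mulmx_cVP => v; rewrite -!mulmxA.
have [x ->] := vcons_surj v.
have [x' ->] := vcons_surj x.
by rewrite !(mul_dsum_vcons, mul_theta0_vcons, mul1r).
Qed.

(* Only [a 0, ..., a m.-1] matter; [a m'] is the last Verblunsky coefficient. *)
Fixpoint rcmv m (a : nat -> C) (b : C) : 'M[C]_m.+1 :=
  if m is m'.+1 then theta0 m' (a m') *m dsum b^* (rcmv m' a 1)^T else b^*%:M.

Lemma eq_rcmv m (a a' : nat -> C) b : (forall k, (k < m)%N -> a k = a' k) ->
  rcmv m a b = rcmv m a' b.
Proof.
elim: m b => //= m IH b aa'; rewrite (IH 1) ?aa' // => k km.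
by apply: aa'; rewrite ltnS ltnW.
Qed.

Lemma det_rcmv m (a : nat -> C) b : \det (rcmv m a b) = (-1) ^+ m * b^*.
Proof.
elim: m b => [|m IH] b /=; first by rewrite det_scalar1 mul1r.
by rewrite det_mulmx det_theta0 det_dsum det_tr IH rmorph1 mulr1 exprS mulrAC mulrA.
Qed.

Lemma rcmv_inj m (a a' : nat -> C) (b b' : C) (W : 'M[C]_m.+1) :
  (forall k, (k < m)%N -> `|a k| < 1) -> (forall k, (k < m)%N -> `|a' k| < 1) ->
  b != 0 ->
  W \is unitarymx -> W *m vcons 1 0 = vcons 1 0 ->
  W *m rcmv m a b = rcmv m a' b' *m W -> rcmv m a b = rcmv m a' b'.
Proof.
elim: m a a' b b' W => [|m IH] a a' b b' W a1 a1' b0 Wu We WF.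
  have W1 : W = 1%:M.
    have [x ->] := unitary_col0 Wu We; rewrite (_ : x = 1%:M) ?dsum1 //.
    by apply/matrixP => -[].
  by move: WF; rewrite W1 mul1mx mulmx1.
(* Intertwined matrices have equal determinants, and by [det_rcmv] these depend only on [b] and
   [b']. *)
have bb : b^* = b'^*.
  have dW : \det W != 0 by rewrite -unitfE -unitmxE unitarymx_unit.
  apply: (@mulfI _ ((-1) ^+ m.+1)); first by rewrite signr_eq0.
  rewrite -(det_rcmv _ a) -(det_rcmv _ a').
  by apply: (mulfI dW); rewrite -det_mulmx WF det_mulmx mulrC.
have bJ0 : b^* != 0 by rewrite conjC_eq0.
have [W' WE Wu'] := unitary_col0 Wu We.
move: WF; rewrite /= -bb.
set K := rcmv m a 1; set K' := rcmv m a' 1 => WF.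
(* Compare first columns: the first coordinates give equal last coefficients; the others, as
   [rho (a m)] is nonzero, show that [W'] also fixes its first basis vector. *)
have := congr1 (mulmx^~ (vcons 1 0)) WF.
rewrite -!mulmxA We !(mul_dsum_vcons, mulmx0, mulr1, mul1r).
have Z : 0 = vcons 0 0 :> 'cV[C]_m.+1 by rewrite vcons0.
rewrite !Z.
rewrite !mul_theta0_vcons WE mul_dsum_vcons !mulr0 !addr0 mul1r.
move=> /vcons_inj[/(mulIf bJ0)/oppr_inj aa].
rewrite -aa => Wr.
have c0 : rho (a m) * b^* != 0 by rewrite mulf_neq0 // gt_eqF // rho_gt0 // a1.
have We' : W' *m vcons 1 0 = vcons 1 0.
  apply: (scalerI c0); rewrite scalemxAr !scale_vcons mulr1 scaler0.
  exact: Wr.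
have [W'' WE' Wu''] := unitary_col0 Wu' We'.
(* [W] is now the identity on the two coordinates where [theta0] acts, so [theta0] commutes with it
   and cancels. *)
have KK : W' *m K^T = K'^T *m W'.
  move: WF; rewrite -aa WE WE' !mulmxA -theta0_dsumC -!mulmxA.
  move/(mulmx_unitary_inj (theta0_unitary _ (ltW (a1 m (ltnSn m))))).
  by rewrite -WE' !mul_dsum mul1r mulr1 => /dsum_inj[].
(* Transposing reverses the intertwining, so the induction hypothesis is applied with [a] and [a']
   exchanged. *)
congr (_ *m dsum _ _^T); symmetry; apply: (IH _ _ _ _ W'^T).
- by move=> k km; apply/a1'/ltnW.
- by move=> k km; apply/a1/ltnW.
- by rewrite oner_eq0.
- by rewrite trmx_unitary.
- by rewrite WE' tr_dsum mul_dsum_vcons mulmx0 mulr1.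
- by apply: trmx_inj; rewrite !trmx_mul !trmxK.
Qed.

End Theta.

(** * Existence of the recursive form, by stripping Theta factors *)

Section Existence.
Local Open Scope sesquilinear_scope.
Variable C : numClosedFieldType.

(** For unitary [U] this is cyclicity of the first basis vector, in the eigenvector form that passes
    easily to smaller blocks. *)
Definition cyclic0 n (U : 'M[C]_n.+1) :=
  forall (x : 'cV_n.+1) l, U *m x = l *: x -> x 0 0 = 0 -> x = 0.

(** Entrywise conjugation turns an eigenvector of [U^T] for [l] into one of [U] for [l^*^-1] and
    keeps a vanishing first coordinate. *)
Lemma cyclic0_tr n (U : 'M[C]_n.+1) :
  U \is unitarymx -> cyclic0 U -> cyclic0 U^T.
Proof.
move=> Uu Uc x l Ux x0.
have xK : map_mx Num.conj (map_mx Num.conj x) = x by apply/matrixP=> i j; rewrite !mxE conjCK.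
have : map_mx Num.conj x = l^* *: (U *m map_mx Num.conj x).
  have := congr1 (fun A => map_mx Num.conj A) Ux.
  rewrite map_mxM map_mxZ => /(congr1 (mulmx U)).
  by rewrite mulmxA (unitarymxP Uu) mul1mx -scalemxAr.
have [->|l0] := eqVneq l 0.
  rewrite conjC0 scale0r => xc0; rewrite -xK xc0.
  by apply/matrixP=> i j; rewrite !mxE conjC0.
move=> xE; rewrite -xK (Uc (map_mx Num.conj x) (l^*^-1)) ?map_mx0 //.
  by rewrite [in RHS]xE scalerA mulVf ?scale1r ?conjC_eq0.
by rewrite mxE x0 conjC0.
Qed.

Lemma unitary_cV0 n (r : 'cV[C]_n.+1) c :
  c != 0 -> r^t* *m r = (c * c^*)%:M ->
  exists2 Q : 'M[C]_n.+1, Q \is unitarymx & Q *m r = vcons c 0.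
Proof.
move=> c0 rr; have cJ0 : c^* != 0 by rewrite conjC_eq0.
have [|Q Qu Q0] := @unitary_row0 C n ((c^*)^-1 *: r^t*).
  rewrite linearZ /= map_mxZ trmxCK -scalemxAl -scalemxAr rr fmorphV /= conjCK scalerA.
  by rewrite scale_scalar_mx; congr _%:M; field; rewrite c0 cJ0.
exists Q => //.
have -> : r = c *: (row 0 Q)^t*.
  rewrite Q0 linearZ /= map_mxZ trmxCK fmorphV /= conjCK scalerA mulfV ?scale1r //.
rewrite -scalemxAr; suff -> : Q *m (row 0 Q)^t* = vcons 1 0.
  by rewrite scale_vcons mulr1 scaler0.
apply/colP => i; transitivity ((Q *m Q^t*) i 0).
  by rewrite !mxE; apply: eq_bigr => k _; rewrite !mxE.
rewrite (unitarymxP Qu) mxE.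
by case: (unliftP 0 i) => [k ->|->]; rewrite ?vconsSE ?vcons0E ?mxE.
Qed.

(* The entrywise conjugate of [V] intertwines [A] and [F^T]. *)
Lemma intertwine_tr n (V A F : 'M[C]_n.+1) :
  V \is unitarymx -> V *m vcons 1 0 = vcons 1 0 -> V *m A^T = F *m V ->
  exists Z : 'M[C]_n.+1,
    [/\ Z \is unitarymx, Z *m vcons 1 0 = vcons 1 0 & Z *m A = F^T *m Z].
Proof.
move=> Vu Ve VA; have VTu : V^T \is unitarymx by rewrite trmx_unitary.
have Zu : V^T^t* \is unitarymx by rewrite trmxC_unitary.
exists (V^T^t*); split=> //.
  have [B VE _] := unitary_col0 Vu Ve.
  by rewrite VE tr_dsum trC_dsum mul_dsum_vcons mulmx0 conjC1 mulr1.
have VTA : A *m V^T = V^T *m F^T by rewrite -!trmx_mul -VA trmx_mul trmxK.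
have /unitarymxCP ZV := VTu.
by rewrite -[F^T]mul1mx -ZV -!mulmxA [V^T *m _]mulmxA -VTA -!mulmxA
  (unitarymxP VTu) mulmx1.
Qed.

Lemma rcmv_exists m (U : 'M[C]_m.+1) b :
  U \is unitarymx -> cyclic0 U -> `|b| = 1 -> \det U = (-1) ^+ m * b^* ->
  exists a : nat -> C, exists2 V : 'M[C]_m.+1, (forall k, `|a k| < 1) &
    [/\ V \is unitarymx, V *m vcons 1 0 = vcons 1 0 &
        V *m U = rcmv m a b *m V].
Proof.
elim: m U b => [|m IH] U b Uu Uc b1 dU.
  exists (fun=> 0), 1%:M => [k|]; first by rewrite normr0 ltr01.
  split; rewrite ?mul1mx ?mulmx1 //=; first by apply/unitarymxP; rewrite trmx1 map_mx1 mulmx1.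
  by rewrite [U]mx11_scalar -det_mx11 dU mul1r.
have [r ur] := vcons_surj (U *m vcons 1 0).
set u0 := _ 0 0 in ur.
have bb : b * b^* = 1 by rewrite -normCK b1 expr1n.
have bJ0 : b^* != 0 by rewrite conjC_eq0 -normr_eq0 b1 oner_eq0.
have rr : r^t* *m r = (1 - u0^* * u0)%:M.
  have := congr1 (fun A => A^t* *m A) ur.
  rewrite trmx_mul map_mxM -mulmxA (mulmx_trmxCA _ Uu) !mul_trC_vcons mulmx0 addr0.
  rewrite conjC1 mulr1 => e; apply: (addrI (u0^* * u0)%:M); rewrite -e.
  by rewrite -raddfD /= addrC subrK.
have rrE : 1 - u0^* * u0 = \sum_k `|r k 0| ^+ 2.
  have /matrixP/(_ 0 0) := rr; rewrite !mxE mulr1n => <-.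
  by apply: eq_bigr => k _; rewrite !mxE normCKC.
(* Chosen so that [theta0 m a *m vcons b^* 0] has first coordinate [- a * b^* = u0]. *)
pose a := - (b * u0).
have nau : `|a| = `|u0| by rewrite normrN normrM b1 mul1r.
have a1 : `|a| < 1.
  rewrite nau lt_neqAle; apply/andP; split; last first.
    rewrite -(@expr_le1 _ 2) // -subr_ge0 normCKC rrE.
    by apply: sumr_ge0 => k _; rewrite exprn_ge0.
  (* Otherwise [U] splits off the first basis vector, and its complementary
     block has an eigenvector, on which the first coordinate vanishes. *)
  apply/eqP => u1; move: rrE; rewrite -normCKC u1 expr1n subrr => /esym r0.
  have {}r0 : r = 0.
    apply/colP => k; rewrite mxE.
    have /(_ (fun k _ => exprn_ge0 _ (normr_ge0 _)))/= := psumr_eq0P _ r0.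
    by move=> /(_ k isT)/eqP; rewrite sqrf_eq0 normr_eq0 => /eqP.
  rewrite r0 in ur; have [A UA Au] := unitary_col0 Uu ur.
  have [l /eigenvalueP[v vA v0]] := eigenvalue_closed A^T (ltn0Sn m).
  have /vcons_inj[_ vT0] : vcons 0 v^T = vcons 0 0.
    rewrite vcons0; apply: (Uc _ l); last by rewrite vcons0E.
    rewrite UA mul_dsum_vcons scale_vcons !mulr0; congr vcons.
    by apply: trmx_inj; rewrite trmx_mul trmxK vA linearZ /= trmxK.
  by move: v0; rewrite -[v]trmxK vT0 trmx0 eqxx.
(* The second coordinate of that same vector; its modulus is the norm of [r], so a unitary [Q] can
   rotate [r] onto it. *)
pose c := rho a * b^*.
have c0 : c != 0 by rewrite mulf_neq0 // gt_eqF // rho_gt0.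
have rJ : (rho a)^* = rho a by apply/conj_Creal/ger0_real/rho_ge0/ltW.
have [|Q Qu Qr] := @unitary_cV0 m r c c0.
  rewrite rr; congr _%:M; rewrite rmorphM /= conjCK rJ mulrACA [b^* * b]mulrC bb mulr1.
  by rewrite -expr2 sqr_rho nau -normCKC.
pose V1 := dsum 1 Q.
have V1u : V1 \is unitarymx by rewrite dsum_unitary normr1 eqxx.
(* Both sides have the same first column, so removing [theta0] leaves a unitary that scales the
   first basis vector by [b^*], and hence splits. *)
have [A VUE Au] : exists2 A : 'M[C]_m.+1,
    V1 *m U *m V1^t* = theta0 m a *m dsum b^* A & A \is unitarymx.
  have Tu : theta0 m a \is unitarymx by apply/theta0_unitary/ltW.
  have [||A AE Au] := @unitary_col0 C _ ((theta0 m a)^t* *m (V1 *m U *m V1^t*)) b^*.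
  - by rewrite !mul_unitarymx ?trmxC_unitary.
  - have -> : vcons b^* 0 = (theta0 m a)^t* *m (theta0 m a *m vcons b^* (vcons 0 0)).
      by rewrite mulmx_trmxCA // vcons0.
    rewrite -!mulmxA; congr (_ *m _).
    rewrite trC_dsum mul_dsum_vcons conjC1 mulr1 mulmx0 ur mul_dsum_vcons Qr.
    rewrite mul_theta0_vcons !mulr0 !addr0 mul1r; congr vcons.
    by rewrite /a opprK mulrAC bb mul1r.
  by exists A; rewrite // -AE mulmxA (unitarymxP Tu) mul1mx.
have V1U : V1 *m U = theta0 m a *m dsum b^* A *m V1.
  by rewrite -VUE mulmxKtV.
have dA : \det A^T = (-1) ^+ m * 1^*.
  have dV : \det V1 != 0 by rewrite -unitfE -unitmxE unitarymx_unit.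
  have /(congr1 determinant) := V1U; rewrite !det_mulmx mulrC => /(mulIf dV).
  rewrite dU det_theta0 det_dsum exprS -mulrA !mulN1r => /oppr_inj.
  by rewrite mulrC => /(mulfI bJ0) e; rewrite det_tr conjC1 mulr1 e.
(* Extended by a zero, such an [x] vanishes on both coordinates that [theta0] moves, so it is an
   eigenvector of [V1 *m U *m V1^t*]; conjugating back by [V1] keeps the first coordinate zero. *)
have Ac : cyclic0 A.
  move=> x l Ax x0.
  have [x' xE] := vcons_surj x; rewrite x0 in xE.
  have Uy : V1 *m U *m (V1^t* *m vcons 0 x) = l *: vcons 0 x.
    rewrite mulmxA VUE -mulmxA mul_dsum_vcons mulr0 Ax xE !scale_vcons !mulr0.
    by rewrite mul_theta0_vcons !mulr0 !addr0.
  have y0 : V1^t* *m vcons 0 x = 0.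
    apply: (Uc _ l); last by rewrite trC_dsum mul_dsum_vcons vcons0E mulr0.
    apply: (mulmx_unitary_inj V1u); rewrite mulmxA Uy -scalemxAr mulmxA.
    by rewrite (unitarymxP V1u) mul1mx.
  have /vcons_inj[] : vcons 0 x = vcons 0 0 => //.
  by rewrite -[LHS]mul1mx -(unitarymxP V1u) -mulmxA y0 mulmx0 vcons0.
have ATu : A^T \is unitarymx by rewrite trmx_unitary.
have [a' [V' a'1 [V'u V'e V'A]]] :=
  IH A^T 1 ATu (cyclic0_tr Au Ac) (normr1 _) dA.
(* The recursion contains the transpose of the smaller [rcmv], so the relation for [A^T] is turned
   into one for [A]. *)
have [Z [Zu Ze ZA]] := intertwine_tr V'u V'e V'A.
have [Z' ZE _] := unitary_col0 Zu Ze.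
exists (fun k => if k == m then a else a' k), (dsum 1 Z *m V1) => [k|]; first by case: ifP.
split.
- by rewrite mul_unitarymx // dsum_unitary normr1 eqxx.
- by rewrite -mulmxA !mul_dsum_vcons !mulmx0 !mulr1.
rewrite /= eqxx -[LHS]mulmxA V1U !mulmxA; congr (_ *m _).
rewrite ZE -theta0_dsumC -ZE -!mulmxA !mul_dsum mulr1 mul1r ZA.
congr (_ *m dsum _ (_^T *m _)); apply: eq_rcmv => k km.
by rewrite ltn_eqF.
Qed.

End Existence.

(** * Identification of the recursive form with the CMV product in the reversed basis *)

Section Factors.
Variable C : numClosedFieldType.
Implicit Types (a : nat -> C) (b : C) (p : bool).

(* The entries of [L] ([p = false]) and of [M] ([p = true]) when [a] lists the
   coefficients [alpha_0, ..., alpha_(m-1), beta]: the incomplete last block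
   [conj beta] is then the corner of [Theta(beta)], and the initial [1] of [M]
   is the value of [- alpha_(-1)]. *)
Definition cmv_entry p a (i j : nat) : C :=
  if i == j then
    if odd i == p then (a i)^* else if i is i'.+1 then - a i' else 1
  else if (j == i.+1) && (odd i == p) then rho (a i)
  else if (i == j.+1) && (odd j == p) then rho (a j)
  else 0.

Definition set_seq m a b k : C := if k == m then b else a k.

(** [L] or [M] in the reversed basis, so that the last block comes first. *)
Definition rfactor p a m : 'M[C]_m.+1 :=
  \matrix_(i, j) cmv_entry p a (m - i) (m - j).

(** Within the matrix, coefficient [m] can enter only at the corner [(m, m)], and only if a block
    starts at [m]; its other entries lie beyond index [m]. *)
Lemma cmv_entry_set m p a b i j : (i <= m)%N -> (j <= m)%N ->
  (odd m == p) ==> ((i != m) || (j != m)) ->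
  cmv_entry p (set_seq m a b) i j = cmv_entry p a i j.
Proof.
move=> im jm ijm; rewrite /cmv_entry /set_seq.
have [ij|ij] := eqVneq i j.
  rewrite -ij orbb in ijm.
  have [oi|oi] := eqVneq (odd i) p; last first.
    by case: i im {ij ijm oi} => // i im; rewrite ltn_eqF.
  have [E|//] := eqVneq i m.
  by move: ijm; rewrite -E oi eqxx /= eqxx.
case: (j =P i.+1) => [E|_] /=.
  by rewrite [i == m]ltn_eqF -?E // [i == j.+1]ltn_eqF // E ltnS leqW.
by case: (i =P j.+1) => [E|//] /=; rewrite [j == m]ltn_eqF // -E.
Qed.

Lemma tr_rfactor p a m : (rfactor p a m)^T = rfactor p a m.
Proof.
apply/matrixP => i j; rewrite !mxE /cmv_entry.
move: (m - i)%N (m - j)%N => {i j} i j.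
rewrite eq_sym; have [->//|_] := eqVneq i j.
have [E|_] //= := eqVneq i j.+1; have [E'|_] //= := eqVneq j i.+1.
by exfalso; lia.
Qed.

Lemma rfactor_set m a b : rfactor (~~ odd m) (set_seq m a b) m = rfactor (~~ odd m) a m.
Proof.
apply/matrixP => i j; rewrite !mxE cmv_entry_set ?leq_subr //.
by case: (odd m).
Qed.

(** In this parity a block starts at the last index; only its corner [b^*] remains, and reversal
    puts it first. *)
Lemma rfactor_dsum m a b :
  rfactor (odd m.+1) (set_seq m.+1 a b) m.+1 = dsum b^* (rfactor (odd m.+1) a m).
Proof.
apply/matrixP => i j; rewrite mxE.
have [i' ->|->] := unliftP 0 i; last first.
  rewrite dsum0E subn0; have [j' ->|->] := unliftP 0 j; last first.
    by rewrite subn0 /cmv_entry !eqxx /set_seq eqxx mulr1.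
  rewrite mulr0 lift0 subSS /cmv_entry.
  case: eqP => [|_]; first lia.
  case: eqP => [|_] /=; first lia.
  by case: eqP => //= -[<-] /=; case: (odd m).
rewrite lift0 subSS.
have [j' ->|->] := unliftP 0 j; last first.
  rewrite dsumE0 mulr0 subn0 /cmv_entry.
  case: eqP => [|_]; first lia.
  rewrite [_ == m.+2]ltn_eqF; last lia.
  by case: eqP => //= -[<-]; case: (odd m).
rewrite dsumES mxE lift0 subSS cmv_entry_set ?leqW ?leq_subr //.
by rewrite ltn_eqF ?implybT // ltnS leq_subr.
Qed.

Lemma theta0_mul_dsum m x (Y : 'M[C]_m.+1) (i j : 'I_m.+2) :
  (forall k, Y 0 k = (k == 0)%:R) ->
  (theta0 m x *m dsum 1 Y) i j =
  if (i < 2)%N then if (j < 2)%N then theta x (1 - i) (1 - j) else 0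
  else dsum 1 Y i j.
Proof.
move=> Y0; have X1 k : dsum 1 Y (lift 0 0) k = (k == lift 0 0)%:R.
  have [k' ->|->] := unliftP 0 k; last by rewrite dsumE0 mulr0.
  by rewrite dsumES Y0 (inj_eq lift_inj).
rewrite mxE; case: ifP => i2; last first.
  rewrite (bigD1 i) //= big1 => [|k ki]; rewrite theta0E i2 /=.
    by rewrite eqxx mul1r addr0.
  by rewrite eq_sym (negPf ki) mul0r.
rewrite 2!big_ord_recl big1 => [|k _]; last first.
  by rewrite theta0E i2 /= -val_eqE ltn_eqF ?mul0r //= (leq_trans i2).
rewrite dsum0E X1 addr0 !theta0E i2 /= mul1r -!val_eqE /=.
by case: (nat_of_ord j) => [|[|j']] /=; rewrite ?mulr1 ?mulr0 ?addr0 ?add0r.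
Qed.

(** In this parity the last block is a full [Theta(a m)]. Setting coefficient [m] to 1 makes the
    corner of the smaller factor 1, so [theta0] meets an identity on its two coordinates. *)
Lemma rfactor_theta0 m a :
  rfactor (odd m) a m.+1 = theta0 m (a m) *m dsum 1 (rfactor (odd m) (set_seq m a 1) m).
Proof.
set Y := rfactor _ _ m.
have Y0 k : Y 0 k = (k == 0)%:R.
  rewrite mxE subn0 -val_eqE /cmv_entry /set_seq /= !eqxx.
  have km : (k <= m)%N by rewrite -ltnS.
  have [/eqP k0|k0] := boolP (k == 0 :> nat)%N; first by rewrite k0 subn0 eqxx conjC1.
  have k1 : (0 < k)%N by rewrite lt0n.
  rewrite [m == _]gtn_eqF; last lia.
  rewrite [_ == m.+1]ltn_eqF /=; last by rewrite ltnS leq_subr.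
  case: ifP => // /andP[/eqP E].
  have -> : odd m = ~~ odd (m - k) by rewrite -oddS; congr odd.
  by case: (odd _).
apply/matrixP => i j; rewrite theta0_mul_dsum // mxE.
have im : (i <= m.+1)%N by rewrite -ltnS.
have jm : (j <= m.+1)%N by rewrite -ltnS.
case: ifP => i2.
  move: (nat_of_ord i) (nat_of_ord j) im jm i2 => {i j Y Y0} i j im jm i2.
  rewrite /cmv_entry; case: (ltnP j 2) => j2.
    case: i i2 {im} => [|[|//]] _; case: j j2 {jm} => [|[|//]] _;
      rewrite ?subSS ?subn0 ?eqxx /theta /=.
    + by case: (odd m).
    + by rewrite gtn_eqF ?ltn_eqF // ltnS leqW.
    + by rewrite ltn_eqF.
    + by [].
  case: eqP => [|_]; first lia.
  case: eqP => [|_] /=; first lia.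
  case: eqP => //= E; have -> : odd m = ~~ odd (m.+1 - j) by rewrite -oddS; congr odd; lia.
  by case: (odd _).
have [i' Ei|Ei] := unliftP 0 i; last by rewrite Ei in i2.
rewrite /= in i' Ei.
have i'E : i = i'.+1 :> nat by rewrite Ei.
have [j' Ej|Ej] := unliftP 0 j.
  rewrite /= in j' Ej.
  have j'E : j = j'.+1 :> nat by rewrite Ej.
  rewrite Ei Ej dsumES mxE !lift0 !subSS cmv_entry_set ?leq_subr //.
  by rewrite [_ == m]ltn_eqF ?implybT //; lia.
rewrite Ei Ej dsumE0 mulr0 subn0 lift0 subSS /cmv_entry.
by do 2 (case: eqP => [|_] /=; first lia); case: eqP => //=; lia.
Qed.

(** The transpose in the recursion exchanges the two symmetric factors: one then absorbs [theta0],
    the other [b^*], and the parities alternate. *)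
Lemma rcmvE m a b :
  rcmv m a b = rfactor (~~ odd m) a m *m rfactor (odd m) (set_seq m a b) m.
Proof.
elim: m b => [|m IH] b.
  apply/matrixP => i j; rewrite !ord1 !mxE big_ord1 !mxE.
  by rewrite /cmv_entry /= /set_seq eqxx mul1r.
rewrite /= IH trmx_mul !tr_rfactor -[b^*]mul1r -mul_dsum mulmxA -rfactor_theta0.
by rewrite -rfactor_dsum negbK.
Qed.

Lemma cmv_entryFE m a i j : (i <= m)%N -> (j <= m)%N ->
  cmv_entry false a i j =
  if (i./2.*2 < m)%N then
    if i./2 == j./2 then theta (a i./2.*2) (i - i./2.*2) (j - i./2.*2) else 0
  else if j == i then (a m)^* else 0.
Proof.
rewrite -(odd_double_half i) -(odd_double_half j).
move: (odd i) (odd j) (i./2) (j./2) => c d h k.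
rewrite !half_bit_double addnK => im jm; rewrite /cmv_entry !oddD !odd_double !addbF !oddb.
have [hk|hk] := eqVneq h k.
  rewrite -hk in jm *; rewrite addnK.
  case: c d im jm => [] [] im jm; rewrite ?add0n ?add1n ?eqxx /theta /=.
  - by rewrite im.
  - by rewrite gtn_eqF // andbF im.
  - by rewrite ltn_eqF // [(_ < m)%N]jm.
  - by case: ltnP => // mh; congr (a _)^*; apply/eqP; rewrite eqn_leq im.
rewrite [RHS](_ : _ = 0); last by case: ifP => // _; case: eqP => //; lia.
case: eqP => [|_]; first lia.
(* Adjacent indices in different blocks have an odd smaller index, so no [rho] joins two blocks. *)
have aux (e f : bool) (p q : nat) : p != q -> ((e + p.*2 == (f + q.*2).+1) && (f == false))%N = false.
  move=> pq; case: f; rewrite ?andbF ?andbT //.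
  by case: e; rewrite ?add0n ?add1n; apply/eqP; lia.
by rewrite !aux // eq_sym.
Qed.

(** Without its initial 1, [M] is built like [L] from the shifted coefficients, so the block
    computation for [L] serves both. *)
Lemma cmv_entryTSS a i j :
  cmv_entry true a i.+1 j.+1 = cmv_entry false (a \o S) i j.
Proof.
rewrite /cmv_entry /= !eqSS !eqb_id !eqbF_neg.
by case: i.
Qed.

Lemma CMV_LE m (alpha : 'I_m -> C) beta : CMV_L alpha beta =
  \matrix_(i, j) cmv_entry false (set_seq m (aget alpha) beta) i j.
Proof.
apply/matrixP => -[i im] [j jm]; rewrite !mxE (@cmv_entryFE m) // /set_seq eqxx.
by rewrite ltnS; case: ifP => // bm; rewrite [_ == m]ltn_eqF.
Qed.

Lemma CMV_ME m (alpha : 'I_m -> C) beta : CMV_M alpha beta =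
  \matrix_(i, j) cmv_entry true (set_seq m (aget alpha) beta) i j.
Proof.
apply/matrixP => -[i im] [j jm]; rewrite !mxE /=.
case: i im => [|i] im; case: j jm => [|j] jm //=.
- by rewrite /cmv_entry /= andbF.
- by rewrite /cmv_entry /= andbF.
rewrite cmv_entryTSS; case: m alpha im jm => // m alpha im jm.
rewrite (@cmv_entryFE m) // !ltnS eqSS /set_seq /= eqxx.
by case: ifP => // bm; rewrite !eqSS [_ == m]ltn_eqF.
Qed.

Definition rev_mx n (A : 'M[C]_n) : 'M[C]_n := mxsub (@rev_ord n) (@rev_ord n) A.

Lemma rev_mxK n : involutive (@rev_mx n).
Proof. by move=> A; apply/matrixP => i j; rewrite !mxE !rev_ordK. Qed.

Lemma rev_mxM n (A B : 'M[C]_n) : rev_mx (A *m B) = rev_mx A *m rev_mx B.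
Proof.
apply/matrixP => i j; rewrite !mxE (reindex_inj rev_ord_inj).
by apply: eq_bigr => k _; rewrite !mxE.
Qed.

Lemma rev_CMV m (alpha : 'I_m -> C) beta : rev_mx (CMV alpha beta) =
  if odd m then rcmv m (aget alpha) beta else (rcmv m (aget alpha) beta)^T.
Proof.
set e := set_seq m (aget alpha) beta.
have -> : rev_mx (CMV alpha beta) = rfactor false e m *m rfactor true e m.
  rewrite /CMV rev_mxM CMV_LE CMV_ME; congr (_ *m _);
  by apply/matrixP => i j; rewrite !mxE /= !subSS.
(* For even [m] the recursive form lists the two symmetric factors in the opposite order, hence the
   transpose. *)
rewrite rcmvE -(rfactor_set _ _ beta); case: (odd m) => //=.
by rewrite trmx_mul !tr_rfactor.
Qed.

End Factors.

(** * Spectral measures and diagonalizations; uniqueness and existence of the CMV matrix *)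

Section Spectral.
Local Open Scope sesquilinear_scope.
Variable C : numClosedFieldType.
Variables (m : nat) (xi nu : 'I_m.+1 -> C).
Hypotheses (xi_inj : injective xi) (xi1 : forall j, `|xi j| = 1).
Hypotheses (nu_gt0 : forall j, 0 < nu j).

Let D : 'M[C]_m.+1 := diag_mx (\row_j xi j).

Lemma sqrt_nu_gt0 j : 0 < sqrtC (nu j).
Proof. by rewrite sqrtC_gt0. Qed.

Lemma conj_sqrt_nu j : (sqrtC (nu j))^* = sqrtC (nu j).
Proof. exact/conj_Creal/gtr0_real/sqrt_nu_gt0. Qed.

(** Row 0 stands for [e_n] after reversal. Fixing the order and the phases of the eigenvectors makes
    row 0 of [H] depend on [nu] alone. *)
Definition diagonalizes (A H : 'M[C]_m.+1) :=
  [/\ H \is unitarymx, A *m H = H *m D & forall j, H 0 j = sqrtC (nu j)].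

Definition rev_rows (H : 'M[C]_m.+1) : 'M[C]_m.+1 := mxsub (@rev_ord _) id H.

Lemma mulmx_col n p q (A : 'M[C]_(n, p)) (B : 'M[C]_(p, q)) j :
  A *m col j B = col j (A *m B).
Proof. by rewrite !colE mulmxA. Qed.

Lemma rev_rows_unitary H : H \is unitarymx -> rev_rows H \is unitarymx.
Proof.
move=> /unitarymxP HH; apply/unitarymxP/matrixP => i j.
have /matrixP/(_ (rev_ord i) (rev_ord j)) := HH.
rewrite !mxE (inj_eq rev_ord_inj) => <-.
by apply: eq_bigr => k _; rewrite !mxE.
Qed.

Lemma mul_rev_rows A H : rev_mx A *m rev_rows H = rev_rows (A *m H).
Proof.
apply/matrixP => i j; rewrite !mxE (reindex_inj rev_ord_inj).
by apply: eq_bigr => k _; rewrite !mxE rev_ordK.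
Qed.

Lemma rev_rows_mul H A : rev_rows (H *m A) = rev_rows H *m A.
Proof. by apply/matrixP => i j; rewrite !mxE; apply: eq_bigr => k _; rewrite !mxE. Qed.

Lemma point_masses_inj k (z w : 'I_k -> C) j : injective z ->
  point_masses z w (z j) = w j.
Proof.
move=> z_inj; rewrite /point_masses (bigD1 j) //= big1 => [|l lj].
  by rewrite eqxx mulr1 addr0.
by rewrite (inj_eq z_inj) eq_sym (negPf lj) mulr0.
Qed.

Lemma nth_spectral_diag A : nth_spectral_measure A (point_masses xi nu) ->
  exists H, diagonalizes (rev_mx A) H.
Proof.
case=> zeta [H [HH [AH muE]]].
pose w k := `|H ord_max k| ^+ 2.
have nuE j : nu j = point_masses zeta w (xi j).
  by rewrite -muE point_masses_inj.
have /fin_all_exists[s sE] j : exists k, zeta k = xi j.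
  have [/existsP[k /eqP]|] := boolP [exists k, zeta k == xi j]; first by exists k.
  rewrite negb_exists => /forallP nz; have := nu_gt0 j.
  rewrite nuE /point_masses big1 ?ltxx // => k _.
  by rewrite eq_sym (negPf (nz k)) mulr0.
(* An injective self-map of a finite index set is bijective, so the eigenvalues [zeta] are distinct
   and no masses merge. *)
have s_inj : injective s by move=> i j sij; apply: xi_inj; rewrite -!sE sij.
have [g gK sK] := injF_bij s_inj.
have zeta_inj : injective zeta.
  by move=> k l; rewrite -[k]sK -[l]sK !sE => /xi_inj ->.
pose h j := H ord_max (s j).
have hE j : `|h j| ^+ 2 = nu j by rewrite nuE -sE point_masses_inj.
have h0 j : `|h j| != 0.
  by apply/eqP => e; have := nu_gt0 j; rewrite -hE e expr0n ltxx.
(* The phase that makes the last coordinate of the eigenvector positive. *)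
pose c j := (h j)^* / `|h j|.
have cc j : (c j)^* * c j = 1.
  rewrite -normCKC normrM normfV norm_conjC normr_id divff ?expr1n //.
exists (\matrix_(i, j) (H (rev_ord i) (s j) * c j)); split.
- apply/unitarymxCP/matrixP => i j; rewrite !mxE.
  transitivity ((c i)^* * c j * (((map_mx Num.conj H)^T *m H) (s i) (s j))).
    rewrite mxE mulr_sumr (reindex_inj rev_ord_inj); apply: eq_bigr => k _.
    rewrite !mxE rev_ordK rmorphM /=; ring.
  rewrite HH mxE (inj_eq s_inj); case: eqP => [->|_]; last by rewrite mulr0.
  by rewrite cc mulr1.
- apply/matrixP => i j; rewrite /D mul_mx_diag !mxE.
  have /colP/(_ (rev_ord i)) := AH (s j); rewrite mulmx_col !mxE sE => e.
  rewrite [RHS]mulrC mulrA -e; rewrite mulr_suml (reindex_inj rev_ord_inj).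
  by apply: eq_bigr => k _; rewrite !mxE rev_ordK mulrA.
- move=> j; rewrite mxE -hE sqrCK // -/(h j).
  have -> : rev_ord 0 = ord_max :> 'I_m.+1 by apply: val_inj; rewrite /= subn1.
  by rewrite -/(h j) /c mulrA -normCK expr2 mulfK.
Qed.

Lemma diagonalizes_nth A H : diagonalizes (rev_mx A) H ->
  nth_spectral_measure A (point_masses xi nu).
Proof.
case=> Hu AH H0; exists xi, (rev_rows H); split.
  by rewrite map_trmx; apply/unitarymxCP/rev_rows_unitary.
split=> [j|].
  rewrite mulmx_col -[A]rev_mxK mul_rev_rows AH rev_rows_mul.
  apply/colP => i; rewrite mxE /D mul_mx_diag !mxE mulrC.
  by [].
congr (point_masses xi _); apply/funext => j.
have revm : rev_ord ord_max = 0 :> 'I_m.+1 by apply: val_inj; rewrite /= subnn.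
by rewrite mxE revm H0 gtr0_norm ?sqrt_nu_gt0 // sqrtCK.
Qed.

(** [H' *m H^t*] matches the eigenvectors; it fixes the first basis vector because [H] and [H'] have
    the same first row. *)
Lemma diagonalizes_intertwine A A' H H' :
  diagonalizes A H -> diagonalizes A' H' ->
  exists W : 'M[C]_m.+1, [/\ W \is unitarymx, W *m vcons 1 0 = vcons 1 0 &
                             W *m A = A' *m W].
Proof.
move=> [Hu AH H0] [Hu' AH' H0']; exists (H' *m H^t*); split.
- by rewrite mul_unitarymx // trmxC_unitary.
- rewrite -mulmxA; have -> : H^t* *m vcons 1 0 = H'^t* *m vcons 1 0.
    apply/colP => i; rewrite !mxE; apply: eq_bigr => k _; rewrite !mxE.
    have [l ->|->] := unliftP 0 k; last by rewrite H0 H0'.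
    by rewrite vconsSE mxE !mulr0.
  by rewrite mulmxA (unitarymxP Hu') mul1mx.
rewrite mulmxA AH' -!mulmxA; congr (_ *m _).
by rewrite -[A in LHS](mulmxtVK A Hu) AH -!mulmxA mulmx_trmxCA.
Qed.

Lemma CMV_unique (al al' : 'I_m -> C) be be' :
  (forall k, `|al k| < 1) -> `|be| = 1 ->
  (forall k, `|al' k| < 1) -> `|be'| = 1 ->
  nth_spectral_measure (CMV al be) (point_masses xi nu) ->
  nth_spectral_measure (CMV al' be') (point_masses xi nu) ->
  CMV al be = CMV al' be'.
Proof.
move=> al1 be1 al1' be1' /nth_spectral_diag[H dH] /nth_spectral_diag[H' dH'].
apply: (can_inj (@rev_mxK _ _)).
have [W [Wu We]] := diagonalizes_intertwine dH dH'.
have aget1 (a : 'I_m -> C) k : (forall k, `|a k| < 1) -> `|aget a k| < 1.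
  by move=> a1; rewrite /aget; case: insub => // ; rewrite normr0 ltr01.
have nz (b : C) : `|b| = 1 -> b != 0 by move=> b1; rewrite -normr_eq0 b1 oner_eq0.
rewrite !rev_CMV; case: (odd m) => WA.
  by apply: (rcmv_inj _ _ _ Wu We WA) => [k _|k _|]; auto.
(* Transposing the relation reverses its direction, hence the exchanged sides and [W^T]. *)
congr trmx; symmetry.
have [B WB _] := unitary_col0 Wu We.
apply: (@rcmv_inj _ _ _ _ _ _ W^T); auto.
- by rewrite trmx_unitary.
- by rewrite WB tr_dsum mul_dsum_vcons mulmx0 mulr1.
- by apply: trmx_inj; rewrite !trmx_mul !trmxK.
Qed.

Hypothesis nu_sum1 : \sum_j nu j = 1.

Lemma CMV_exists : exists (al : 'I_m -> C) be,
  [/\ forall k, `|al k| < 1, `|be| = 1 &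
      nth_spectral_measure (CMV al be) (point_masses xi nu)].
Proof.
(* The columns of [Q] serve as eigenvectors: [U] below has eigenvalues [xi] and weights [nu] at the
   first basis vector. *)
have [|Q Qu Q0] := @unitary_row0 C m (\row_j sqrtC (nu j)).
  apply/matrixP => i j; rewrite !ord1 !mxE -nu_sum1; apply: eq_bigr => k _.
  by rewrite !mxE conj_sqrt_nu -expr2 sqrtCK.
have QE j : Q 0 j = sqrtC (nu j) by have /rowP/(_ j) := Q0; rewrite !mxE.
pose U := Q *m D *m Q^t*.
have Du : D \is unitarymx.
  apply/unitarymxP; rewrite /D tr_diag_mx map_diag_mx mulmx_diag.
  rewrite -diag_const_mx; congr diag_mx; apply/rowP => j.
  by rewrite !mxE -normCK xi1 expr1n.
have Uu : U \is unitarymx by rewrite !mul_unitarymx ?trmxC_unitary.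
have QU : Q^t* *m U = D *m Q^t* by rewrite /U -mulmxA mulmx_trmxCA.
(* As the [xi j] are distinct, an eigenvector is a multiple of one column of [Q], whose first
   coordinate is nonzero. *)
have Uc : cyclic0 U.
  move=> x l Ux x0.
  pose y := Q^t* *m x.
  have xE : x = Q *m y by rewrite /y mulmxA (unitarymxP Qu) mul1mx.
  have Dy j : xi j * y j 0 = l * y j 0.
    have : D *m y = l *: y by rewrite /y mulmxA -QU -mulmxA Ux -scalemxAr.
    by rewrite /D mul_diag_mx => /colP/(_ j); rewrite !mxE.
  suff y0 : y = 0 by rewrite xE y0 mulmx0.
  apply/colP => j; rewrite [RHS]mxE; apply/eqP/negP => /negP yj.
  have lE : xi j = l by apply: (mulIf yj); rewrite Dy.
  have : x 0 0 = sqrtC (nu j) * y j 0.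
    rewrite xE mxE (bigD1 j) //= big1 ?QE ?addr0 // => k kj.
    have [->|yk] := eqVneq (y k 0) 0; first by rewrite mulr0.
    move: kj; rewrite -(inj_eq xi_inj) lE; case/eqP.
    by apply: (mulIf yk); rewrite Dy.
  move/eqP; rewrite x0 eq_sym mulf_eq0 (negPf yj) orbF.
  by rewrite gt_eqF ?sqrt_nu_gt0.
have dU1 : `|\det U| = 1.
  apply/eqP; rewrite -(@pexpr_eq1 _ _ 2) ?normr_ge0 // normCK.
  have -> : (\det U)^* = \det (U^t*) by rewrite det_map_mx det_tr.
  by rewrite -det_mulmx (unitarymxP Uu) det1.
(* The sign compensates the [m] Theta factors, each of determinant -1. *)
pose b := ((-1) ^+ m * \det U)^*.
have b1 : `|b| = 1 by rewrite norm_conjC normrM normrX normrN1 expr1n mul1r.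
have bE : \det U = (-1) ^+ m * b^* by rewrite conjCK mulrA -expr2 sqrr_sign mul1r.
have [a a1 [Z [Zu Ze ZU]]] : exists2 a : nat -> C, (forall k, `|a k| < 1) &
    exists Z : 'M[C]_m.+1, [/\ Z \is unitarymx, Z *m vcons 1 0 = vcons 1 0 &
     Z *m U = (if odd m then rcmv m a b else (rcmv m a b)^T) *m Z].
  case: (odd m).
    have [a [V a1 VP]] := rcmv_exists Uu Uc b1 bE.
    by exists a => //; exists V.
  (* For even [m] the recursive form is found for [U^T] and transposed back. *)
  have UTu : U^T \is unitarymx by rewrite trmx_unitary.
  have [|a [V a1 [Vu Ve VU]]] := rcmv_exists UTu (cyclic0_tr Uu Uc) b1.
    by rewrite det_tr.
  by exists a => //; apply: intertwine_tr VU.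
exists (fun k => a k), b; split=> //.
apply: (@diagonalizes_nth _ (Z *m Q)); split.
- by rewrite mul_unitarymx.
- have -> : rev_mx (CMV (fun k : 'I_m => a k) b) =
      if odd m then rcmv m a b else (rcmv m a b)^T.
    rewrite rev_CMV (@eq_rcmv _ _ _ a) // => k km.
    by rewrite /aget insubT.
  rewrite mulmxA -ZU -!mulmxA; congr (_ *m _).
  by rewrite !mulmxA mulmxKtV.
move=> j; have [B -> _] := unitary_col0 Zu Ze.
rewrite mxE (bigD1 0) //= big1 => [|k k0].
  by rewrite dsum0E eqxx !mul1r addr0 QE.
by rewrite dsum0E (negPf k0) mulr0 mul0r.
Qed.

End Spectral.

(* n = m.+1 >= 1 ; complex numbers are R[i] for R : realType *)
Theorem theorem1 (R : realType) (m : nat)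
    (xi : 'I_m.+1 -> R[i]) (nu : 'I_m.+1 -> R[i]) :
  injective xi ->
  (forall j, `|xi j| = 1) ->
  (forall j, 0 < nu j) ->
  \sum_(j < m.+1) nu j = 1 ->
  exists (alpha : 'I_m -> R[i]) (beta : R[i]),
    [/\ (forall k, `|alpha k| < 1), `|beta| = 1,
        nth_spectral_measure (CMV alpha beta) (point_masses xi nu) &
        forall (alpha' : 'I_m -> R[i]) (beta' : R[i]),
          (forall k, `|alpha' k| < 1) -> `|beta'| = 1 ->
          nth_spectral_measure (CMV alpha' beta') (point_masses xi nu) ->
          CMV alpha' beta' = CMV alpha beta].
Proof.
move=> xi_inj xi1 nu_gt0 nu1.
have [al [be [al1 be1 sp]]] := CMV_exists xi_inj xi1 nu_gt0 nu1.
exists al, be; split; [exact: al1 | exact: be1 | exact: sp |].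
move=> al' be' al1' be1' sp'.
exact: (CMV_unique xi_inj nu_gt0 al1' be1' al1 be1 sp' sp).
Qed.
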